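(* Let $S_5=\{(-1,3,1,-3),(-1,4,1,-3),(-1,4,0,-4)\}$. If $(t_1,t_2,t_3,t_4)\in S_5$, then for all integers $n\geq 0$, $$a_{1^{t_1}2^{t_2}3^{t_3}4^{t_4}}(4n)>0,\qquad a_{1^{t_1}2^{t_2}3^{t_3}4^{t_4}}(4n+1)>0,$$ $$a_{1^{t_1}2^{t_2}3^{t_3}4^{t_4}}(4n+2)<0,\qquad a_{1^{t_1}2^{t_2}3^{t_3}4^{t_4}}(4n+3)<0.$$
   Context: For $|q|<1$ (or as formal power series in $q$) let $f_j:=(q^j;q^j)_\infty=\prod_{k\ge 1}(1-q^{jk})$ for each positive integer $j$. For a positive integer $m$ and integers $t_1,\dots,t_m$ (possibly zero or negative), the integers $a_{1^{t_1}2^{t_2}\cdots m^{t_m}}(n)$, $n\ge 0$, are defined by $\sum_{n=0}^\infty a_{1^{t_1}2^{t_2}\cdots m^{t_m}}(n)q^n=f_1^{t_1}f_2^{t_2}\cdots f_m^{t_m}$. *)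

(* Defs.v *)
From HB Require Import structures.
From mathcomp Require Import all_boot all_order all_algebra.
From mathcomp Require Import boolp.

Set Implicit Arguments.
Unset Strict Implicit.
Unset Printing Implicit Defensive.

Import Order.TTheory GRing.Theory Num.Theory.

Local Open Scope ring_scope.

(* [u n] is the coefficient of q ^ n in the formal power series [u]. *)
Record fps (R : Type) := Fps { fps_coef :> nat -> R }.

Lemma fpsP (R : Type) (u v : fps R) : (forall n, u n = v n) <-> u = v.
Proof.
split=> [|-> //]; case: u v => [u] [v] /= uv.
by congr Fps; apply/funext.
Qed.

(* Locked, so that unification does not unfold the ring operations below. *)
HB.lock Definition fps_of (R : Type) (c : nat -> R) : fps R := Fps c.

Lemma fpsE (R : Type) (c : nat -> R) n : fps_of c n = c n.
Proof. by rewrite fps_of.unlock. Qed.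

HB.instance Definition _ (R : Type) := gen_eqMixin (fps R).
HB.instance Definition _ (R : Type) := gen_choiceMixin (fps R).

Section FpsRing.

Variable R : comUnitRingType.
Implicit Types u v w : fps R.

Definition fps_zero : fps R := fps_of (fun=> 0).
Definition fps_opp u : fps R := fps_of (fun n => - u n).
Definition fps_add u v : fps R := fps_of (fun n => u n + v n).
Definition fps_one : fps R := fps_of (fun n => (n == 0%N)%:R).
Definition fps_mul u v : fps R :=
  fps_of (fun n => \sum_(i < n.+1) u i * v (n - i)%N).

Fact fps_addA : associative fps_add.
Proof. by move=> u v w; apply/fpsP=> n; rewrite !fpsE addrA. Qed.

Fact fps_addC : commutative fps_add.
Proof. by move=> u v; apply/fpsP=> n; rewrite !fpsE addrC. Qed.

Fact fps_add0 : left_id fps_zero fps_add.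
Proof. by move=> u; apply/fpsP=> n; rewrite !fpsE add0r. Qed.

Fact fps_addN : left_inverse fps_zero fps_opp fps_add.
Proof. by move=> u; apply/fpsP=> n; rewrite !fpsE addNr. Qed.

HB.instance Definition _ :=
  GRing.isZmodule.Build (fps R) fps_addA fps_addC fps_add0 fps_addN.

Definition fps_trunc (N : nat) u : {poly R} := \poly_(i < N.+1) u i.

Lemma coef_fps_trunc N u n : (n <= N)%N -> (fps_trunc N u)`_n = u n.
Proof. by move=> nN; rewrite coef_poly ltnS nN. Qed.

Lemma fps_mulE N u v n : (n <= N)%N ->
  fps_mul u v n = (fps_trunc N u * fps_trunc N v)`_n.
Proof.
move=> nN; rewrite fpsE coefM; apply: eq_bigr => i _.
rewrite !coef_fps_trunc //; first exact: leq_trans (leq_subr _ _) nN.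
by apply: leq_trans nN; rewrite -ltnS.
Qed.

Fact fps_mulC : commutative fps_mul.
Proof. by move=> u v; apply/fpsP=> n; rewrite !(fps_mulE _ _ (leqnn n)) mulrC. Qed.

Fact fps_mulA : associative fps_mul.
Proof.
move=> u v w; apply/fpsP=> n.
transitivity (fps_trunc n u * (fps_trunc n v * fps_trunc n w))`_n.
  rewrite fpsE coefM; apply: eq_bigr => i _.
  by rewrite coef_fps_trunc -1?ltnS // -(fps_mulE _ _ (leq_subr _ _)).
rewrite mulrA fpsE coefM; apply: eq_bigr => i _.
by rewrite coef_fps_trunc ?leq_subr // -fps_mulE // -ltnS.
Qed.

Fact fps_mul1 : left_id fps_one fps_mul.
Proof.
move=> u; apply/fpsP=> n; rewrite fpsE big_ord_recl subn0 fpsE mul1r.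
by rewrite big1 ?addr0 // => i _; rewrite fpsE mul0r.
Qed.

Fact fps_mulDl : left_distributive fps_mul fps_add.
Proof.
move=> u v w; apply/fpsP=> n; rewrite !fpsE -big_split.
by apply: eq_bigr => i _; rewrite fpsE mulrDl.
Qed.

Fact fps_one_neq0 : fps_one != 0.
Proof. by apply/eqP => /fpsP /(_ 0%N) /eqP; rewrite !fpsE oner_eq0. Qed.

HB.instance Definition _ := GRing.Zmodule_isComNzRing.Build (fps R)
  fps_mulA fps_mulC fps_mul1 fps_mulDl fps_one_neq0.

Lemma fps_coef0 n : (0 : fps R) n = 0. Proof. exact: fpsE. Qed.
Lemma fps_coef1 n : (1 : fps R) n = (n == 0%N)%:R. Proof. exact: fpsE. Qed.
Lemma fps_coefN u n : (- u) n = - u n. Proof. exact: fpsE. Qed.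
Lemma fps_coefD u v n : (u + v) n = u n + v n. Proof. exact: fpsE. Qed.
Lemma fps_coefM u v n : (u * v) n = \sum_(i < n.+1) u i * v (n - i)%N.
Proof. exact: fpsE. Qed.

(* The first [n] coefficients of the inverse of a series [u] whose constant
   term is a unit, obtained by solving u * u^-1 = 1 degree by degree. *)
Fixpoint fps_inv_seq u (n : nat) : seq R :=
  if n is m.+1 then
    let s := fps_inv_seq u m in
    rcons s ((u 0%N)^-1 *
             ((m == 0%N)%:R - \sum_(i < m) u i.+1 * s`_(m - i.+1)))
  else [::].

Definition fps_unit : {pred fps R} :=
  [pred u : fps R | u 0%N \is a GRing.unit].

Definition fps_inv u : fps R :=
  if u \in fps_unit then fps_of (fun n => (fps_inv_seq u n.+1)`_n) else u.

Lemma size_fps_inv_seq u n : size (fps_inv_seq u n) = n.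
Proof. by elim: n => //= n IHn; rewrite size_rcons IHn. Qed.

Lemma nth_fps_inv_seq u n m : (m < n)%N ->
  (fps_inv_seq u n)`_m = (fps_inv_seq u m.+1)`_m.
Proof.
elim: n => // n IHn; rewrite ltnS leq_eqVlt => /predU1P[-> //|mn].
by rewrite [fps_inv_seq u n.+1]/= nth_rcons size_fps_inv_seq mn IHn.
Qed.

Fact fps_mulV : {in fps_unit, left_inverse 1 fps_inv *%R}.
Proof.
move=> u uU; rewrite mulrC; apply/fpsP=> n.
rewrite fps_coefM fps_coef1 big_ord_recl subn0 /fps_inv uU.
have u0 : u 0%N \is a GRing.unit by [].
rewrite fpsE [X in _ * X + _]/= nth_rcons size_fps_inv_seq ltnn eqxx mulVKr //.
rewrite -addrA [X in _ + X](_ : _ = 0) ?addr0 //; apply/eqP.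
rewrite addrC subr_eq0; apply/eqP/eq_bigr => i _.
rewrite fpsE; congr (_ * _).
rewrite [RHS]nth_fps_inv_seq // ltn_subrL.
exact: leq_ltn_trans (ltn_ord i).
Qed.

Fact fps_unitP u v : v * u = 1 -> u \in fps_unit.
Proof.
move=> /fpsP /(_ 0%N); rewrite fps_coefM fps_coef1 big_ord1 => vu1.
by apply/unitrPr; exists (v 0%N); rewrite mulrC.
Qed.

Fact fps_inv_out : {in [predC fps_unit], fps_inv =1 id}.
Proof. by move=> u; rewrite inE /fps_inv => /negPf ->. Qed.

HB.instance Definition _ := GRing.ComNzRing_hasMulInverse.Build (fps R)
  fps_mulV fps_unitP fps_inv_out.

Lemma fps_unitE u : (u \is a GRing.unit) = (u 0%N \is a GRing.unit).
Proof. by []. Qed.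

End FpsRing.

(* f_j = \prod_(k >= 1) (1 - q ^ (j k)), for j > 0: the factors with k > n do
   not contribute to the coefficient of q ^ n, see [coef_qf] below. *)
Definition qf (j : nat) : fps int :=
  fps_of (fun n => (\prod_(1 <= k < n.+1) (1 - 'X^(j * k)) : {poly int})`_n).

Lemma coef_qf (j n N : nat) : (0 < j)%N -> (n <= N)%N ->
  (\prod_(1 <= k < N.+1) (1 - 'X^(j * k)) : {poly int})`_n = qf j n.
Proof.
move=> j0; rewrite fpsE; elim: N => [|N IHN]; first by rewrite leqn0 => /eqP ->.
rewrite leq_eqVlt => /predU1P[-> //|nN].
rewrite big_nat_recr //= mulrBr mulr1 coefB IHN // coefMXn.
by rewrite (leq_trans nN) ?leq_pmull ?subr0.
Qed.

Lemma qf_unit (j : nat) : qf j \is a GRing.unit.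
Proof. by rewrite fps_unitE fpsE big_geq // coef1. Qed.

(* [eta_coef [:: t_1; ...; t_m] n] is the coefficient of q ^ n in
   f_1 ^ t_1 * ... * f_m ^ t_m, with integer exponents. *)
Definition eta_coef (t : seq int) (n : nat) : int :=
  (\prod_(i < size t) qf i.+1 ^ t`_i) n.

Definition S5 : seq (int * int * int * int) :=
  [:: (-1, 3, 1, -3); (-1, 4, 1, -3); (-1, 4, 0, -4)].

(* Main.v *)
(* Split a series F by the parity of the exponent.  The claim is that the two
   parts, as series in q ^ 2, become series with positive coefficients once
   q ^ 2 is replaced by - q.  Each of the three quotients is a theta function
   T(q) times an eta quotient U(q ^ 2), so the two parts are half of T times
   U(- q), where f_j(- q) = f_{2j} ^ 3 / (f_j f_{4j}) for j odd.

   - For (-1,3,1,-3) and (-1,4,1,-3), T = f_2 ^ 2 f_3 f_{12} / (f_1 f_4 f_6)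
     = sum_k q ^ (3 k ^ 2 + 2 k), whose exponents are all 0 or 1 modulo 4, so
     both halves keep nonnegative coefficients, and U(- q) is positive.
   - For (-1,4,0,-4), T = f_2 ^ 2 / f_1 = sum_k q ^ (2 k ^ 2 + k).  By the Jacobi
     triple product its halves at - q are the infinite products for
     f(- q ^ 3, - q ^ 5) and f(- q, - q ^ 7), whose product with U(- q) is
     prod_k (1 - q ^ k) ^ (e k) with all e k <= 0.

   Identities between eta quotients reduce to identities between the exponents
   e k in prod_k (1 - q ^ k) ^ (e k), which are periodic in k. *)
From HB Require Import structures.
Require Import Defs.
From mathcomp Require Import all_boot all_order all_algebra.
From mathcomp Require Import zify ring.
Set Implicit Arguments.
Unset Strict Implicit.
Unset Printing Implicit Defensive.

Import Order.TTheory GRing.Theory Num.Theory.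
Local Open Scope ring_scope.

Local Notation ps := (fps int).

(** * Power series up to a given degree, infinite products *)

(** Congruence modulo q ^ (L + 1). It respects the ring operations, so identities between infinite
    products or sums can be checked on finite ones. *)
Definition eqm (L : nat) (u v : ps) := forall n, (n <= L)%N -> u n = v n.

Lemma eqm_refl L u : eqm L u u. Proof. by []. Qed.
Lemma eqm_sym L u v : eqm L u v -> eqm L v u.
Proof. by move=> uv n /uv ->. Qed.
Lemma eqm_trans L v u w : eqm L u v -> eqm L v w -> eqm L u w.
Proof. by move=> uv vw n nL; rewrite uv ?vw. Qed.
#[local] Hint Resolve eqm_refl : core.

Lemma eqm_le K L u v : (K <= L)%N -> eqm L u v -> eqm K u v.
Proof. by move=> KL uv n nK; apply/uv/(leq_trans nK). Qed.

Lemma eqmP u v : (forall L, eqm L u v) -> u = v.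
Proof. by move=> uv; apply/fpsP => n; apply: (uv n). Qed.

Lemma eqmM L u u' v v' : eqm L u u' -> eqm L v v' -> eqm L (u * v) (u' * v').
Proof.
move=> uu vv n nL; rewrite !fps_coefM; apply: eq_bigr => i _.
by rewrite uu ?vv //; have := ltn_ord i; lia.
Qed.

Lemma eqmD L u u' v v' : eqm L u u' -> eqm L v v' -> eqm L (u + v) (u' + v').
Proof. by move=> uu vv n nL; rewrite !fps_coefD uu ?vv. Qed.

Lemma eqm_prod L (I : Type) (r : seq I) (P : pred I) (F G : I -> ps) :
  (forall i, P i -> eqm L (F i) (G i)) ->
  eqm L (\prod_(i <- r | P i) F i) (\prod_(i <- r | P i) G i).
Proof. by move=> FG; elim/big_ind2: _ => // *; apply: eqmM. Qed.

Lemma eqm_sum L (I : Type) (r : seq I) (P : pred I) (F G : I -> ps) :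
  (forall i, P i -> eqm L (F i) (G i)) ->
  eqm L (\sum_(i <- r | P i) F i) (\sum_(i <- r | P i) G i).
Proof. by move=> FG; elim/big_ind2: _ => // *; apply: eqmD. Qed.

Lemma eqmV L u v : u \is a GRing.unit -> v \is a GRing.unit ->
  eqm L u v -> eqm L u^-1 v^-1.
Proof.
move=> uU vU uv.
have -> : u^-1 = u^-1 * (v * v^-1) by rewrite divrr ?mulr1.
rewrite -[X in eqm L _ X]mul1r -(mulVr uU) -mulrA.
by do 2?apply: eqmM => //; apply: eqm_sym.
Qed.

Lemma eqmX L u v n : eqm L u v -> eqm L (u ^+ n) (v ^+ n).
Proof.
by move=> uv; elim: n => // n IHn; rewrite !exprS; apply: eqmM.
Qed.

Lemma eqmXz L u v (z : int) : u \is a GRing.unit -> v \is a GRing.unit ->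
  eqm L u v -> eqm L (u ^ z) (v ^ z).
Proof.
move=> uU vU uv; case: z => n; first exact: eqmX.
by apply: eqmV; rewrite ?unitrX //; apply: eqmX.
Qed.

HB.lock Definition qmon (m : nat) : ps := fps_of (fun n => (n == m)%:R).

Lemma qmonE m n : qmon m n = (n == m)%:R. Proof. by rewrite qmon.unlock fpsE. Qed.

Lemma coef_qmonM m u n : (qmon m * u) n = if (m <= n)%N then u (n - m)%N else 0.
Proof.
rewrite fps_coefM; case: leqP => mn.
  rewrite (bigD1 (Ordinal (mn : m < n.+1)%N)) //= qmonE eqxx mul1r.
  rewrite big1 ?addr0 // => i; rewrite qmonE -val_eqE /= => /negPf ->.
  by rewrite mul0r.
rewrite big1 // => i _; rewrite qmonE; case: eqP => [im|]; last by rewrite mul0r.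
by have := ltn_ord i; lia.
Qed.

Lemma qmonM m n : qmon m * qmon n = qmon (m + n).
Proof.
apply/fpsP => k; rewrite coef_qmonM !qmonE; case: leqP => mk.
  by congr (_%:R); lia.
by case: eqP => //; lia.
Qed.

Lemma qmon0 : qmon 0 = 1.
Proof. by apply/fpsP => k; rewrite qmonE fps_coef1. Qed.

Lemma eqm_qmonM L m u : (L < m)%N -> eqm L (qmon m * u) 0.
Proof.
by move=> Lm n nL; rewrite coef_qmonM fps_coef0 leqNgt (leq_ltn_trans nL Lm).
Qed.

Lemma fps_coef0M (u v : ps) : (u * v) 0%N = u 0%N * v 0%N.
Proof. by rewrite fps_coefM big_ord1. Qed.

Lemma fps_coef0_prod (I : Type) (r : seq I) (P : pred I) (F : I -> ps) :
  (\prod_(i <- r | P i) F i) 0%N = \prod_(i <- r | P i) F i 0%N.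
Proof. by elim/big_rec2: _ => [|i a u _ <-]; rewrite ?fps_coef1 ?fps_coef0M. Qed.

Lemma unit_coef0 (u : ps) : u 0%N = 1 -> u \is a GRing.unit.
Proof. by rewrite fps_unitE => ->; apply: unitr1. Qed.

Definition geo (m : nat) : ps := 1 - qmon m.

Lemma geo_coef0 m : (0 < m)%N -> geo m 0%N = 1.
Proof.
by case: m => // m _; rewrite /geo fps_coefD fps_coefN fps_coef1 qmonE subr0.
Qed.

Lemma geo_unit m : (0 < m)%N -> geo m \is a GRing.unit.
Proof. by move=> m0; apply/unit_coef0/geo_coef0. Qed.

Lemma eqm_geo L m : (L < m)%N -> eqm L (geo m) 1.
Proof.
move=> Lm n nL; rewrite /geo fps_coefD fps_coefN qmonE; case: eqP; first lia.
by rewrite subr0.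
Qed.

(* F k = 1 + O(q ^ k.+1), so the n-th coefficient of the infinite product only
   involves the factors F 0, ..., F n. *)
Definition admissible (F : nat -> ps) := forall k, eqm k (F k) 1.

Definition pinf (F : nat -> ps) : ps :=
  fps_of (fun n => (\prod_(k < n.+1) F k) n).

Lemma eqm_prod_ord F L K : admissible F -> (L < K)%N ->
  eqm L (\prod_(k < K) F k) (\prod_(k < L.+1) F k).
Proof.
move=> admF LK; rewrite -(subnKC LK) big_split_ord /=.
rewrite -[X in eqm L _ X]mulr1; apply: eqmM => //.
apply: (@eqm_trans _ (\prod_(i < K - L.+1) 1)); last by rewrite big1_eq.
by apply: eqm_prod => i _; apply: eqm_le (admF _); rewrite /=; lia.
Qed.

Lemma eqm_pinf F L K : admissible F -> (L < K)%N ->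
  eqm L (pinf F) (\prod_(k < K) F k).
Proof.
move=> admF LK n nL; rewrite fpsE; apply/esym/eqm_prod_ord => //; lia.
Qed.

Lemma eq_pinf F G : F =1 G -> pinf F = pinf G.
Proof. by move=> FG; apply/fpsP => n; rewrite !fpsE; under eq_bigr do rewrite FG. Qed.

Lemma pinf_coef0 F : admissible F -> pinf F 0%N = 1.
Proof. by move=> admF; rewrite fpsE big_ord1 (admF 0%N) // fps_coef1. Qed.

Lemma pinfM F G : admissible F -> admissible G ->
  pinf F * pinf G = pinf (fun k => F k * G k).
Proof.
move=> admF admG; apply: eqmP => L.
have admFG : admissible (fun k => F k * G k).
  by move=> k; rewrite -[1]mulr1; apply: eqmM.
apply: eqm_trans (eqm_sym (@eqm_pinf _ L L.+1 admFG _)) => //.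
by rewrite big_split; apply: eqmM; apply: eqm_pinf.
Qed.

(** * Eta quotients, encoded by the exponents of the factors 1 - q ^ k *)

Definition eta (e : nat -> int) : ps := pinf (fun k => geo k.+1 ^ e k.+1).

Lemma admissible_eta (e : nat -> int) : admissible (fun k => geo k.+1 ^ e k.+1).
Proof.
move=> k; rewrite -[X in eqm _ _ X](exp1rz _ (e k.+1)).
by apply: eqmXz; rewrite ?geo_unit ?unitr1 //; apply: eqm_geo.
Qed.
#[local] Hint Resolve admissible_eta : core.

Lemma eqm_eta e L K : (L < K)%N ->
  eqm L (eta e) (\prod_(k < K) geo k.+1 ^ e k.+1).
Proof. exact: eqm_pinf. Qed.

Lemma eta_coef0 e : eta e 0%N = 1.
Proof. exact: pinf_coef0. Qed.

Lemma eta_unit e : eta e \is a GRing.unit.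
Proof. exact/unit_coef0/eta_coef0. Qed.

Lemma etaD e1 e2 : eta e1 * eta e2 = eta (fun k => e1 k + e2 k).
Proof.
rewrite pinfM //; apply: eq_pinf => k.
by rewrite exprzDr // geo_unit.
Qed.

Lemma eq_eta e1 e2 : e1 =1 e2 -> eta e1 = eta e2.
Proof. by move=> ee; apply: eq_pinf => k; rewrite ee. Qed.

Lemma eta0 : eta (fun=> 0) = 1.
Proof. by apply/fpsP => n; rewrite fpsE big1. Qed.

Lemma etaN e : (eta e)^-1 = eta (fun k => - e k).
Proof.
apply: (mulrI (eta_unit e)); rewrite divrr ?eta_unit // etaD -eta0.
by apply: eq_eta => k; rewrite subrr.
Qed.

Lemma etaX e n : eta e ^+ n = eta (fun k => e k *+ n).
Proof.
elim: n => [|n IHn]; first by rewrite expr0 -eta0; apply: eq_eta.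
by rewrite exprS IHn etaD; apply: eq_eta => k; rewrite mulrS.
Qed.

Lemma etaXz e (z : int) : eta e ^ z = eta (fun k => z * e k).
Proof.
case: z => n; first by rewrite -exprnP etaX; apply: eq_eta => k; rewrite -mulr_natl natz.
rewrite NegzE -exprnN etaX etaN; apply: eq_eta => k.
by rewrite mulNr -mulr_natl natz.
Qed.

(** * The substitutions q -> - q and q -> q ^ 2 *)

Definition psneg (u : ps) : ps := fps_of (fun n => (-1) ^+ n * u n).
Definition psdil (u : ps) : ps := fps_of (fun n => if odd n then 0 else u n./2).

Lemma psnegE u n : psneg u n = (-1) ^+ n * u n. Proof. exact: fpsE. Qed.
Lemma psdilE u n : psdil u n = if odd n then 0 else u n./2.
Proof. exact: fpsE. Qed.

Fact psneg_zmod : zmod_morphism psneg.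
Proof.
by move=> u v; apply/fpsP=> n; rewrite !(psnegE, fps_coefD, fps_coefN) mulrBr.
Qed.
HB.instance Definition _ := GRing.isZmodMorphism.Build ps ps psneg psneg_zmod.

Fact psneg_monoid : monoid_morphism psneg.
Proof.
split=> [|u v]; apply/fpsP => n.
  by rewrite psnegE !fps_coef1; case: n => [|n]; rewrite ?mulr0 ?mulr1.
rewrite psnegE !fps_coefM mulr_sumr; apply: eq_bigr => i _.
rewrite !psnegE mulrACA -exprD subnKC //.
by rewrite -ltnS.
Qed.
HB.instance Definition _ := GRing.isMonoidMorphism.Build ps ps psneg psneg_monoid.

Fact psdil_zmod : zmod_morphism psdil.
Proof.
move=> u v; apply/fpsP=> n; rewrite !(psdilE, fps_coefD, fps_coefN).
by case: odd; rewrite ?subr0.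
Qed.
HB.instance Definition _ := GRing.isZmodMorphism.Build ps ps psdil psdil_zmod.

Lemma sum_double (V : zmodType) (F : nat -> V) n :
  \sum_(i < n.*2) F i = \sum_(i < n) (F i.*2 + F i.*2.+1).
Proof.
elim: n => [|n IHn]; first by rewrite !big_ord0.
by rewrite doubleS !big_ord_recr /= IHn addrA.
Qed.

(** Only even degrees occur in [psdil v], so each parity class of the product involves a single
    parity class of [u]. *)
Lemma coefM_psdil u v (r : bool) n :
  (u * psdil v) (n.*2 + r)%N = \sum_(i < n.+1) v i * u ((n - i).*2 + r)%N.
Proof.
rewrite mulrC fps_coefM.
(* Zeros pad the sum to 2 (n + 1) terms, to be paired as 2 i, 2 i + 1; for r = 0 one term is
   added. *)
transitivity (\sum_(i < n.+1.*2) if (i <= n.*2 + r)%N then psdil v i * u (n.*2 + r - i)%N else 0).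
  case: r => /=; first by rewrite addn1 doubleS; apply: eq_bigr => i _; rewrite -ltnS ltn_ord.
  rewrite addn0 doubleS [RHS]big_ord_recr /= ltnn addr0.
  by apply: eq_bigr => i _; rewrite -ltnS ltn_ord.
rewrite (sum_double (fun i => if (i <= n.*2 + r)%N then psdil v i * u (n.*2 + r - i)%N else 0)).
apply: eq_bigr => i _; have := ltn_ord i => lin.
rewrite ifT; last lia.
rewrite !psdilE /= odd_double doubleK mul0r; case: ifP => _; rewrite addr0;
  by congr (_ * u _); lia.
Qed.

Fact psdil_monoid : monoid_morphism psdil.
Proof.
split=> [|u v]; apply/fpsP => n.
  by rewrite psdilE !fps_coef1; case: n => [|[|n]] //=; rewrite negbK; case: odd.
rewrite -[n]odd_double_half addnC coefM_psdil psdilE oddD odd_double oddb.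
case on: (odd n) => /=.
  rewrite big1 // => i _; rewrite psdilE oddD odd_double /= mulr0 //.
rewrite addn0 doubleK fps_coefM; rewrite -/(_ * _) -fps_coefM mulrC fps_coefM.
by apply: eq_bigr => i _; rewrite addn0 psdilE odd_double doubleK.
Qed.
HB.instance Definition _ := GRing.isMonoidMorphism.Build ps ps psdil psdil_monoid.

Lemma eqm_psneg L u v : eqm L u v -> eqm L (psneg u) (psneg v).
Proof. by move=> uv n nL; rewrite !psnegE uv. Qed.

Lemma eqm_psdil L u v : eqm L u v -> eqm L (psdil u) (psdil v).
Proof.
by move=> uv n nL; rewrite !psdilE uv //; rewrite (leq_trans _ nL) //; lia.
Qed.

Lemma psneg_geo m : psneg (geo m) = if odd m then 1 + qmon m else geo m.
Proof.
apply/fpsP => n; rewrite psnegE /geo fps_coefD fps_coefN fps_coef1 qmonE.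
have -> : (-1) ^+ n * ((n == 0%N)%:R - (n == m)%:R) =
   (n == 0%N)%:R - (-1) ^+ m * (n == m)%:R :> int.
  rewrite mulrBr; congr (_ - _); last by case: eqP => [->|]; rewrite ?mulr0.
  by case: n => [|n]; rewrite ?mulr0 ?mulr1.
rewrite -signr_odd; case: odd; rewrite !fps_coefD ?fps_coefN fps_coef1 qmonE.
  by rewrite mulN1r opprK.
by rewrite mul1r.
Qed.

Lemma psdil_geo m : psdil (geo m) = geo m.*2.
Proof.
rewrite /geo rmorphB rmorph1; congr (_ - _); apply/fpsP => n.
rewrite psdilE !qmonE; case on: (odd n); first by case: eqP => // nm; lia.
by congr (_%:R); lia.
Qed.

Lemma psneg_pinf F : admissible F ->
  psneg (pinf F) = pinf (fun k => psneg (F k)).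
Proof.
move=> admF; have admG : admissible (fun k => psneg (F k)).
  by move=> k; rewrite -[1](rmorph1 psneg); apply: eqm_psneg.
apply: eqmP => L; apply: eqm_trans (eqm_psneg (@eqm_pinf _ _ L.+1 admF _)) _ => //.
by rewrite rmorph_prod; apply/eqm_sym/eqm_pinf.
Qed.

Lemma psdil_pinf F : admissible F ->
  psdil (pinf F) = pinf (fun k => psdil (F k)).
Proof.
move=> admF; have admG : admissible (fun k => psdil (F k)).
  by move=> k; rewrite -[1](rmorph1 psdil); apply: eqm_psdil.
apply: eqmP => L; apply: eqm_trans (eqm_psdil (@eqm_pinf _ _ L.+1 admF _)) _ => //.
by rewrite rmorph_prod; apply/eqm_sym/eqm_pinf.
Qed.

Definition dil_exp (e : nat -> int) (k : nat) : int := if odd k then 0 else e k./2.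

Lemma psdil_eta e : psdil (eta e) = eta (dil_exp e).
Proof.
rewrite psdil_pinf //; apply: eqmP => L.
have admG : admissible (fun k => psdil (geo k.+1 ^ e k.+1)).
  by move=> k; rewrite -[1](rmorph1 psdil); apply/eqm_psdil/admissible_eta.
apply: eqm_trans (@eqm_pinf _ _ L.+1 admG _) _ => //; apply: eqm_sym.
apply: eqm_trans (@eqm_eta (dil_exp e) _ L.+1.*2 _) _; first lia.
(* The dilated exponent is 0 at 2 K + 1 and e (K + 1) at 2 K + 2, so 2 K dilated factors match K
   original ones. *)
elim: L.+1 => [|K IHK]; first by rewrite !big_ord0.
rewrite doubleS !big_ord_recr /= -mulrA; apply: eqmM => //.
have -> : dil_exp e K.*2.+1 = 0 by rewrite /dil_exp /= odd_double.
have -> : dil_exp e K.*2.+2 = e K.+1 by rewrite /dil_exp -doubleS odd_double doubleK.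
by rewrite expr0z mul1r rmorphXz ?geo_unit //= psdil_geo doubleS.
Qed.

(* For k odd, 1 - (- q) ^ k = (1 - q ^ (2 k)) / (1 - q ^ k). *)
Definition neg_exp (e : nat -> int) (k : nat) : int :=
  if odd k then - e k else e k + (if odd k./2 then e k./2 else 0).

Lemma psneg_eta e : psneg (eta e) = eta (neg_exp e).
Proof.
(* The exponents are split by the parity of k: even factors are fixed by q -> - q, and the odd part
   E satisfies E(- q) = E(q ^ 2) / E(q). *)
pose eo k : int := if odd k then e k else 0.
pose ee k : int := if odd k then 0 else e k.
have negE f k : psneg (geo k.+1 ^ f k.+1) = psneg (geo k.+1) ^ f k.+1.
  by rewrite rmorphXz ?geo_unit.
have admN f : admissible (fun k => psneg (geo k.+1 ^ f k.+1)).
  by move=> k; rewrite -[1](rmorph1 psneg); apply/eqm_psneg/admissible_eta.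
have -> : eta e = eta eo * eta ee.
  by rewrite etaD; apply: eq_eta => k; rewrite /eo /ee; case: odd; rewrite ?addr0 ?add0r.
rewrite rmorphM /=.
have -> : psneg (eta ee) = eta ee.
  rewrite psneg_pinf //; apply: eq_pinf => k; rewrite negE psneg_geo /ee.
  by case: odd; rewrite ?expr0z.
suff -> : psneg (eta eo) = eta (dil_exp eo) * (eta eo)^-1.
  rewrite etaN !etaD; apply: eq_eta => k; rewrite /dil_exp /neg_exp /eo /ee.
  by case: (odd k); case: (odd k./2); ring.
apply: (mulIr (eta_unit eo)); rewrite divrK ?eta_unit // -psdil_eta.
rewrite psneg_pinf // pinfM // psdil_pinf //; apply: eq_pinf => k.
rewrite negE psneg_geo rmorphXz ?geo_unit //= psdil_geo /eo.
rewrite -[~~ odd k]/(odd k.+1); case: odd; last by rewrite !expr0z mulr1.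
have -> : geo k.+1.*2 = (1 + qmon k.+1) * geo k.+1.
  rewrite /geo mulrBr mulr1 mulrDl mul1r qmonM addnn; ring.
rewrite exprMz_comm ?geo_unit //; last exact: mulrC.
by apply: unit_coef0; rewrite fps_coefD fps_coef1 qmonE addr0.
Qed.

Lemma eq_modn_pos M a b : (0 < a <= M)%N -> (0 < b <= M)%N ->
  (a == b %[mod M])%N = (a == b).
Proof.
move=> /andP[a0 aM] /andP[b0 bM].
move: aM bM; rewrite leq_eqVlt => /predU1P[->|aM]; rewrite leq_eqVlt => /predU1P[->|bM];
  rewrite ?modnn ?(modn_small aM) ?(modn_small bM) //; lia.
Qed.

Definition chi (a M : nat) (k : nat) : int := (k == a %[mod M])%N%:R.

(** This is the product (q ^ a; q ^ M)_oo: in each block of M consecutive factors exactly one has a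
    nonzero exponent. *)
Lemma eta_chi a M : (0 < a <= M)%N -> eta (chi a M) = pinf (fun i => geo (a + M * i)).
Proof.
move=> /andP[a0 aM]; have admG : admissible (fun i => geo (a + M * i)).
  by move=> k; apply: eqm_geo; nia.
apply: eqmP => L; apply: eqm_trans (eqm_sym (@eqm_pinf _ L L.+1 admG _)) => //.
apply: eqm_trans (@eqm_eta _ L (M * L.+1) _) _; first nia.
elim: L.+1 => [|K IHK]; first by rewrite muln0 !big_ord0.
rewrite mulnS addnC big_split_ord big_ord_recr /=; apply: eqmM => //.
have lta : (a.-1 < M)%N by lia.
rewrite (bigD1 (Ordinal lta)) //= big1 ?mulr1 => [|i]; last first.
  rewrite -val_eqE /= /chi => ia; rewrite -addnS mulnC modnMDl eq_modn_pos ?a0 ?ltn_ord //.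
  by have -> : (i.+1 == a) = false by lia.
rewrite /chi -addnS prednK // mulnC modnMDl eqxx expr1z.
by rewrite addnC.
Qed.


Definition dvs (j k : nat) : int := (j %| k)%N%:R.

Lemma qf_eta j : (0 < j)%N -> qf j = eta (dvs j).
Proof.
move=> j0; rewrite (@eq_eta _ (chi j j)) => [|k]; last by rewrite /chi modnn.
rewrite eta_chi ?j0 ?leqnn //.
(* The multiplicative embedding of polynomials into series carries the truncated product defining
   f_j to a product of [geo] factors. *)
pose emb (p : {poly int}) : ps := fps_of (fun n => p`_n).
have embM p q : emb (p * q) = emb p * emb q.
  apply/fpsP => n; rewrite fpsE coefM fps_coefM; apply: eq_bigr => i _.
  by rewrite !fpsE.
have emb1 : emb 1 = 1 by apply/fpsP => n; rewrite fpsE coef1 fps_coef1.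
apply/fpsP => n.
transitivity (emb (\prod_(1 <= k < n.+2) (1 - 'X^(j * k))) n).
  by rewrite [RHS]fpsE coef_qf.
rewrite (big_morph emb embM emb1) big_add1 big_mkord fpsE; congr (fps_coef _ _).
apply: eq_bigr => i _; apply/fpsP => m.
by rewrite fpsE coefB coef1 coefXn /geo fps_coefD fps_coefN fps_coef1 qmonE mulnS.
Qed.

(** * Positivity *)

Definition nonneg (u : ps) := forall n, 0 <= u n.
Definition positive (u : ps) := forall n, 0 < u n.

Lemma nonneg1 : nonneg 1.
Proof. by move=> n; rewrite fps_coef1. Qed.

Lemma nonnegM u v : nonneg u -> nonneg v -> nonneg (u * v).
Proof.
by move=> u0 v0 n; rewrite fps_coefM; apply: sumr_ge0 => i _; apply: mulr_ge0.
Qed.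

Lemma nonnegX u n : nonneg u -> nonneg (u ^+ n).
Proof.
move=> u0; elim: n => [|n IHn]; first by rewrite expr0; apply: nonneg1.
by rewrite exprS; apply: nonnegM.
Qed.

Lemma nonneg_prod (I : Type) (r : seq I) (P : pred I) (F : I -> ps) :
  (forall i, P i -> nonneg (F i)) -> nonneg (\prod_(i <- r | P i) F i).
Proof. by move=> F0; elim/big_ind: _ => //; [apply: nonneg1 | apply: nonnegM]. Qed.

Lemma nonneg_pinf F : (forall k, nonneg (F k)) -> nonneg (pinf F).
Proof. by move=> F0 n; rewrite fpsE; apply: nonneg_prod. Qed.

(** In the convolution the term u_n v_0 is positive and the others are nonnegative. *)
Lemma positiveM u v : positive u -> nonneg v -> 0 < v 0%N -> positive (u * v).
Proof.
move=> u0 v0 v00 n; rewrite fps_coefM big_ord_recr /= subnn.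
apply: ltr_wpDl; last exact: mulr_gt0.
by apply: sumr_ge0 => i _; apply/mulr_ge0/v0/ltW.
Qed.

Lemma geoV_rec m n : (0 < m)%N ->
  (geo m)^-1 n = (n == 0%N)%:R + (if (m <= n)%N then (geo m)^-1 (n - m)%N else 0).
Proof.
move=> m0; have /fpsP/(_ n) := mulrV (geo_unit m0).
rewrite {1}/geo mulrBl mul1r fps_coefD fps_coefN coef_qmonM fps_coef1.
by move/eqP; rewrite subr_eq => /eqP.
Qed.

Lemma geoV_nonneg m : (0 < m)%N -> nonneg (geo m)^-1.
Proof.
move=> m0; elim/ltn_ind => n IHn; rewrite geoV_rec //.
by case: leqP => mn; rewrite ?addr0 ?addr_ge0 ?IHn //; lia.
Qed.

Lemma geoV_coef0 m : (0 < m)%N -> (geo m)^-1 0%N = 1.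
Proof. by move=> m0; rewrite geoV_rec // leqNgt m0 addr0. Qed.

Lemma geo1V_positive : positive (geo 1)^-1.
Proof.
by elim=> [|n IHn]; rewrite geoV_rec //= ?add0r ?subn1.
Qed.

Lemma geoXz_nonneg m (z : int) : (0 < m)%N -> z <= 0 -> nonneg (geo m ^ z).
Proof.
case: z => n m0; first by rewrite lez_nat leqn0 => /eqP ->; apply: nonneg1.
by move=> _; rewrite NegzE -exprnN -exprVn; apply/nonnegX/geoV_nonneg.
Qed.

Lemma geo1Xz_positive (z : int) : z < 0 -> positive (geo 1 ^ z).
Proof.
case: z => // n _; rewrite NegzE -exprnN -exprVn exprS; apply: positiveM.
- exact: geo1V_positive.
- exact/nonnegX/geoV_nonneg.
by elim: n => [|n IHn]; rewrite ?expr0 ?fps_coef1 // exprS fps_coef0M geoV_coef0 // mul1r.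
Qed.

(** A negative power of 1 - q already has all coefficients positive; the remaining factors are
    nonnegative with constant term 1. *)
Lemma eta_positive e : (forall k, (0 < k)%N -> e k <= 0) -> e 1%N < 0 ->
  positive (eta e).
Proof.
move=> e0 e1 n; rewrite fpsE big_ord_recl; apply: positiveM; first exact: geo1Xz_positive.
  by apply: nonneg_prod => k _; apply: geoXz_nonneg => //; apply: e0.
by rewrite fps_coef0_prod big1 // => k _; rewrite (@admissible_eta e (bump 0 k)) // fps_coef1.
Qed.

(** Each factor 1 - q ^ k that occurs has k odd and becomes 1 + q ^ k. *)
Lemma psneg_eta_nonneg e :
  (forall k, e k = 0 \/ odd k /\ e k = 1) -> nonneg (psneg (eta e)).
Proof.
move=> e01; rewrite psneg_pinf //; apply: nonneg_pinf => k.
rewrite rmorphXz ?geo_unit //= psneg_geo.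
case: (e01 k.+1) => [->|[-> ->]]; first exact: nonneg1.
by move=> n; rewrite expr1z fps_coefD fps_coef1 qmonE addr_ge0 ?ler0n.
Qed.

(** * The Jacobi triple product *)

Lemma binS2 n : 'C(n.+1, 2) = ('C(n, 2) + n)%N.
Proof. by rewrite binS bin1. Qed.

(** The exponent a k (k + 1) / 2 + b k (k - 1) / 2 of the triple product, kept in [nat] by a case
    split on the sign of k. *)
Definition jexp (a b : nat) (k : int) : nat :=
  match k with
  | Posz n => (a * 'C(n.+1, 2) + b * 'C(n, 2))%N
  | Negz n => (a * 'C(n.+1, 2) + b * 'C(n.+2, 2))%N
  end.

Definition jterm (a b : nat) (k : int) : ps := (-1) ^+ `|k| * qmon (jexp a b k).

Lemma jexp_ge a b k : (0 < a)%N -> (0 < b)%N -> (`|k| <= jexp a b k)%N.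
Proof. by move=> a0 b0; case: k => n /=; rewrite !binS2; nia. Qed.

Lemma jexpN a b k : jexp b a (- k) = jexp a b k.
Proof. by case: k => [[|n]|n]; rewrite ?NegzE ?opprK //= addnC. Qed.

Lemma jtermN a b k : jterm b a (- k) = jterm a b k.
Proof. by rewrite /jterm jexpN abszN. Qed.

(** From k = j - n to k + 1 the exponent grows by a + (a + b) k; the added power of q, which comes
    from the q-Pascal rule, makes the total shift a + (a + b) m, independent of j. *)
Lemma jtermS a b (m n j : nat) : (j <= m + n)%N ->
  qmon ((a + b) * (m + n - j)) * jterm a b (j.+1%:Z - n%:Z) =
  - (qmon (a + (a + b) * m) * jterm a b (j%:Z - n%:Z)).
Proof.
move=> jmn; rewrite /jterm !mulrA ![qmon _ * _]mulrC -!mulrA !qmonM -mulNr.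
case: (leqP n j) => nj.
  rewrite !subzn //; last lia.
  have -> : (j.+1 - n = (j - n).+1)%N by lia.
  rewrite /= exprS mulN1r; congr (_ * qmon _).
  by rewrite !binS2; nia.
have -> : j%:Z - n%:Z = Negz (n - j.+1) by lia.
have -> : j.+1%:Z - n%:Z = - (n - j.+1)%:Z by lia.
rewrite -jexpN opprK abszN /= exprS mulN1r opprK; congr (_ * qmon _).
by rewrite !binS2; nia.
Qed.

(** * Gaussian binomials and the finite triple product *)

Definition qpoch M n : ps := \prod_(i < n) geo (M * i.+1).

Lemma qpochS M n : qpoch M n.+1 = qpoch M n * geo (M * n.+1).
Proof. by rewrite /qpoch big_ord_recr. Qed.

Lemma qpoch_unit M n : (0 < M)%N -> qpoch M n \is a GRing.unit.
Proof.
move=> M_gt0; elim: n => [|n IHn]; first by rewrite /qpoch big_ord0 unitr1.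
by rewrite qpochS unitrM IHn geo_unit // muln_gt0 M_gt0.
Qed.

(** The Gaussian binomial in base q ^ M, as a quotient of series. *)
Definition qbin M n j : ps :=
  if (j <= n)%N then qpoch M n / (qpoch M j * qpoch M (n - j)) else 0.

Lemma qbin0 M n : (0 < M)%N -> qbin M n 0 = 1.
Proof.
by move=> M_gt0; rewrite /qbin subn0 /qpoch big_ord0 mul1r divrr ?qpoch_unit.
Qed.

Lemma qbin_sub M n j : (j <= n)%N -> qbin M n (n - j) = qbin M n j.
Proof. by move=> jn; rewrite /qbin leq_subr jn subKn // [qpoch M j * _]mulrC. Qed.

Lemma qbinn M n : (0 < M)%N -> qbin M n n = 1.
Proof.
by move=> M_gt0; rewrite -(qbin0 n M_gt0) -(qbin_sub M (leq0n n)) subn0.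
Qed.

Lemma qbinS M n j : (0 < M)%N -> (j <= n)%N ->
  qbin M n.+1 j.+1 = qbin M n j.+1 + qmon (M * (n - j)) * qbin M n j.
Proof.
move=> M_gt0; rewrite leq_eqVlt => /predU1P[->|jn].
  by rewrite subnn muln0 qmon0 !qbinn // mulr1 /qbin ltnn add0r.
rewrite /qbin ltnS jn (ltnW jn) subSS.
have -> : (n - j = (n - j.+1).+1)%N by lia.
set d := (n - j.+1)%N; rewrite !qpochS.
have U k : qpoch M k \is a GRing.unit by apply: qpoch_unit.
have G k : geo (M * k.+1) \is a GRing.unit.
  by rewrite geo_unit // muln_gt0 M_gt0.
set D := qpoch M j * geo _ * (_ * _).
have DU : D \is a GRing.unit by rewrite !unitrM !U !G.
apply: (mulIr DU); rewrite divrK // mulrDl.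
have -> : qpoch M n / (qpoch M j * geo (M * j.+1) * qpoch M d) * D = qpoch M n * geo (M * d.+1).
  by rewrite /D ![X in _ / _ * X]mulrA [LHS]mulrA divrK // !unitrM !U G.
have -> : qmon (M * d.+1) * (qpoch M n / (qpoch M j * (qpoch M d * geo (M * d.+1)))) * D =
   qmon (M * d.+1) * (qpoch M n * geo (M * j.+1)).
  rewrite -mulrA; congr (_ * _); rewrite /D [X in _ / _ * X]mulrAC [LHS]mulrA divrK //.
  by rewrite !unitrM !U G.
(* Over the common denominator D the q-Pascal rule is this identity, with d + 1 = n - j. *)
have -> : geo (M * n.+1) = geo (M * d.+1) + qmon (M * d.+1) * geo (M * j.+1).
  rewrite /geo mulrBr qmonM mulr1 -mulnDr (_ : (d.+1 + j.+1 = n.+1)%N); last by rewrite /d; lia.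
  by ring.
by ring.
Qed.

Definition jsum a b m n : ps :=
  \sum_(j < (m + n).+1) qbin (a + b) (m + n) j * jterm a b (j%:Z - n%:Z).

(** Reversing the summation index replaces k by - k, which exchanges a and b. *)
Lemma jsumC a b m n : jsum a b m n = jsum b a n m.
Proof.
rewrite /jsum [(n + m)%N]addnC [(b + a)%N]addnC (reindex_inj rev_ord_inj) /=.
apply: eq_bigr => j _; rewrite subSS qbin_sub -1?ltnS // -jtermN.
by congr (_ * jterm _ _ _); have := ltn_ord j; lia.
Qed.

(** The q-Pascal rule splits the sum in two: one copy of the old sum, and by [jtermS] another
    multiplied by - q ^ (a + (a + b) m). *)
Lemma jsumS a b m n : (0 < a)%N ->
  jsum a b m.+1 n = geo (a + (a + b) * m) * jsum a b m n.
Proof.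
move=> a0; have M0 : (0 < a + b)%N by lia.
rewrite /jsum addSn big_ord_recl qbin0 // mul1r.
under eq_bigr => j _.
  rewrite /= -[bump 0 j]/(j.+1) qbinS -1?ltnS // mulrDl [qmon _ * _ * _]mulrAC jtermS -1?ltnS //.
  over.
rewrite big_split /= addrA /geo mulrBl mul1r; congr (_ + _).
  rewrite -[in LHS](mul1r (jterm _ _ _)) -(qbin0 (m + n) M0).
  (* The top term carries a binomial with j > m + n, which is 0; the separated term j = 0 completes
     the old sum. *)
  rewrite big_ord_recr /= [X in _ + (_ + X)](_ : _ = 0) ?addr0; last first.
    by rewrite /qbin ltnn mul0r.
  by rewrite [RHS]big_ord_recl.
by rewrite -mulNr mulr_sumr; apply: eq_bigr => j _; rewrite !mulNr mulrAC -!mulrA.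
Qed.

(** Induction on m uses [jsumS]; induction on n uses it too, through the symmetry [jsumC]. *)
Lemma finite_jacobi a b m n : (0 < a)%N -> (0 < b)%N ->
  \prod_(i < m) geo (a + (a + b) * i) * \prod_(i < n) geo (b + (a + b) * i) =
  jsum a b m n.
Proof.
move=> a0 b0; have M0 : (0 < a + b)%N by lia.
elim: n => [|n IHn].
  rewrite big_ord0 mulr1; elim: m => [|m IHm].
    rewrite /jsum big_ord0 big_ord1 qbin0 // subrr mul1r /jterm.
    by rewrite (_ : jexp a b 0 = 0%N) ?qmon0 ?mulr1 //= !muln0.
  by rewrite big_ord_recr /= IHm jsumS // mulrC.
rewrite jsumC jsumS // [(b + a)%N]addnC -jsumC -IHn big_ord_recr /=.
by rewrite mulrA [RHS]mulrC.
Qed.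

(* The truncation -K <= k < K of the two-sided series. *)
Definition jpartial a b K : ps := \sum_(j < K.*2) jterm a b (j%:Z - K%:Z).

Lemma jpartialS a b K :
  jpartial a b K.+1 = jterm a b (Negz K) + jpartial a b K + jterm a b K%:Z.
Proof.
rewrite /jpartial doubleS big_ord_recl big_ord_recr /= addrA.
by congr (_ + _ + _); [|apply: eq_bigr => j _|]; congr jterm; rewrite /bump /=; lia.
Qed.

(* Ramanujan's f(- q ^ a, - q ^ b). *)
Definition theta a b : ps := fps_of (fun n => jpartial a b n.+1 n).

Lemma eqm_jterm0 a b k L u : (0 < a)%N -> (0 < b)%N -> (L < jexp a b k)%N ->
  eqm L (u * jterm a b k) 0.
Proof. by move=> a0 b0 Lk; rewrite /jterm mulrA mulrC; apply: eqm_qmonM. Qed.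

Lemma eqm_jpartial a b L K : (0 < a)%N -> (0 < b)%N -> (L < K)%N ->
  eqm L (jpartial a b K) (jpartial a b L.+1).
Proof.
move=> a0 b0; elim: K => // K IHK; rewrite ltnS leq_eqVlt => /predU1P[-> //|LK].
have tail k : (L < `|k|)%N -> eqm L (jterm a b k) 0.
  move=> Lk; rewrite -[jterm _ _ _]mul1r; apply: eqm_jterm0 => //.
  exact/(leq_trans Lk)/jexp_ge.
rewrite jpartialS -[jpartial a b L.+1]add0r -[0 + _]addr0.
by do 2?apply: eqmD; [apply: tail => /=; lia | apply: IHK | apply: tail].
Qed.

Lemma eqm_theta a b L K : (0 < a)%N -> (0 < b)%N -> (L < K)%N ->
  eqm L (theta a b) (jpartial a b K).
Proof. by move=> a0 b0 LK n nL; rewrite fpsE; apply/esym/eqm_jpartial => //; lia. Qed.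

Theorem jacobi_triple a b : (0 < a)%N -> (0 < b)%N ->
  eta (chi a (a + b)) * eta (chi b (a + b)) * eta (dvs (a + b)) = theta a b.
Proof.
move=> a0 b0; have M0 : (0 < a + b)%N by lia.
have QE : eta (dvs (a + b)) = pinf (fun i => geo ((a + b) * i.+1)).
  rewrite (@eq_eta _ (chi (a + b) (a + b))) => [|k]; last by rewrite /chi modnn.
  by rewrite eta_chi ?M0 ?leqnn //; apply: eq_pinf => i; rewrite mulnS.
set Q := eta (dvs _) in QE *.
have Q_unit : Q \is a GRing.unit by apply: eta_unit.
have eqmQ L n : (L < n)%N -> eqm L (qpoch (a + b) n) Q.
  move=> Ln; rewrite QE; apply/eqm_sym/eqm_pinf => // k; apply: eqm_geo; nia.
(* With K = 2 (L + 1), every j with |j - K| <= L satisfies both j > L and 2 K - j > L. *)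
apply: eqmP => L; pose K := L.+1.*2.
apply: eqm_trans (eqm_sym (@eqm_theta _ _ _ K a0 b0 _)); last by rewrite /K; lia.
have LK : (L < K)%N by rewrite /K; lia.
have eqmC c : (0 < c <= a + b)%N ->
    eqm L (eta (chi c (a + b))) (\prod_(i < K) geo (c + (a + b) * i)).
  move=> cM; rewrite eta_chi //; apply: eqm_pinf => // k; apply: eqm_geo; nia.
apply: (@eqm_trans _ (jsum a b K K * Q)).
  by rewrite -finite_jacobi //; do 2?apply: eqmM => //; apply: eqmC; lia.
rewrite /jsum mulr_suml addnn big_ord_recr /= -[jpartial _ _ _]addr0.
(* Either the exponent exceeds L and both sides vanish, or |j - K| <= L and the binomial times Q is
   congruent to Q / (Q * Q) * Q = 1. *)
have term (j : nat) : (j <= K.*2)%N ->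
   eqm L (qbin (a + b) K.*2 j * jterm a b (j%:Z - K%:Z) * Q) (jterm a b (j%:Z - K%:Z)).
  move=> jK; rewrite mulrAC; case: (ltnP L (jexp a b (j%:Z - K%:Z))) => Lj.
    apply: eqm_trans (eqm_jterm0 _ a0 b0 Lj) _; apply: eqm_sym.
    by rewrite -[jterm _ _ _]mul1r; apply: eqm_jterm0.
  have jL := leq_trans (jexp_ge (j%:Z - K%:Z) a0 b0) Lj.
  rewrite -[X in eqm L _ X]mul1r; apply: eqmM => //.
  rewrite /qbin jK [X in eqm L _ X](_ : 1 = Q / (Q * Q) * Q); last first.
    by rewrite invrM // mulrA divrr // mul1r mulVr.
  have [Lj1 Lj2] : (L < j)%N /\ (L < K.*2 - j)%N by rewrite /K in jL jK *; lia.
  apply: eqmM => //; apply: eqmM; first by apply: eqmQ; lia.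
  by apply: eqmV; rewrite ?unitrM ?Q_unit ?qpoch_unit //; apply: eqmM; apply: eqmQ.
apply: eqmD; first by apply: eqm_sum => j _; apply: term; apply: ltnW.
(* The last index j = 2 K, that is k = K, lies outside [jpartial], but its exponent is at least K >
   L. *)
apply: eqm_trans (term _ (leqnn _)) _; rewrite -[jterm _ _ _]mul1r; apply: eqm_jterm0 => //.
by apply: leq_trans (jexp_ge _ a0 b0); lia.
Qed.

(** * Periodic exponents *)

Definition periodic (N : nat) (e : nat -> int) := forall k, e (k + N)%N = e k.

Lemma periodicD N e1 e2 : periodic N e1 -> periodic N e2 ->
  periodic N (fun k => e1 k + e2 k).
Proof. by move=> p1 p2 k; rewrite p1 p2. Qed.

Lemma periodicM N c e : periodic N e -> periodic N (fun k => c * e k).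
Proof. by move=> p k; rewrite p. Qed.

Lemma periodic_chi N a M : (M %| N)%N -> periodic N (chi a M).
Proof. by move=> /dvdnP[m ->] k; rewrite /chi addnC modnMDl. Qed.

Lemma periodic_dvs N j : (j %| N)%N -> periodic N (dvs j).
Proof. by move=> jN k; rewrite /dvs dvdn_addl. Qed.

Lemma periodic_dil N e : periodic N e -> periodic N.*2 (dil_exp e).
Proof.
move=> p k; rewrite /dil_exp oddD odd_double addbF halfD odd_double andbF.
by rewrite doubleK add0n p.
Qed.

(** The period doubles because [neg_exp] reads e at k / 2; N even preserves the parity of k. *)
Lemma periodic_neg N e : ~~ odd N -> periodic N e -> periodic N.*2 (neg_exp e).
Proof.
move=> /negPf eN p k; rewrite /neg_exp oddD odd_double addbF halfD odd_double andbF.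
by rewrite doubleK add0n oddD eN addbF -addnn addnA !p.
Qed.

Lemma periodicP N e : (0 < N)%N -> periodic N e -> forall k, e k = e (k %% N)%N.
Proof.
move=> N0 p k; rewrite {1}(divn_eq k N); elim: (k %/ N)%N => [|m IHm] //.
by rewrite mulSn -addnA addnC p.
Qed.

Lemma eq_eta_periodic N e1 e2 : (0 < N)%N -> periodic N e1 -> periodic N e2 ->
  all (fun k => e1 k == e2 k) (iota 0 N) -> eta e1 = eta e2.
Proof.
move=> N0 p1 p2 /allP e12; apply: eq_eta => k.
rewrite (periodicP N0 p1) (periodicP N0 p2); apply/eqP/e12.
by rewrite mem_iota ltn_pmod.
Qed.

Lemma eta_positive_periodic N e : (0 < N)%N -> periodic N e ->
  all (fun k => e k <= 0) (iota 0 N) -> e 1%N < 0 -> positive (eta e).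
Proof.
move=> N0 p /allP e_le0; apply: eta_positive => k _.
by rewrite (periodicP N0 p) e_le0 // mem_iota ltn_pmod.
Qed.

(** The common period is 24: exponents inside [neg_exp] and [dil_exp] have period 12, which doubles,
    and the other moduli divide 24. *)
Ltac prove_periodic :=
  repeat first [ apply: periodicD | apply: periodicM | exact: periodic_chi
               | exact: periodic_dvs | apply: (@periodic_neg 12) => //
               | apply: (@periodic_dil 12) ].

(** * Coefficients and dissections of theta functions *)

(** Doubling removes the binomials, so parity and residue questions about exponents become integer
    arithmetic. *)
Lemma jexp2 a b (k : int) :
  2 * (jexp a b k)%:Z = a%:Z * (k * (k + 1)) + b%:Z * (k * (k - 1)).
Proof.
have C2 n : 2 * 'C(n, 2)%:Z = n%:Z * (n%:Z - 1).
  elim: n => [|n IHn]; first by rewrite bin0n.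
  by rewrite binS2 PoszD mulrDr IHn -[n.+1]addn1 PoszD; ring.
case: k => n; rewrite [jexp _ _ _]/= PoszD !PoszM mulrDr ![2 * (_ * _)]mulrCA !C2.
  by rewrite -[n.+1]addn1 PoszD; ring.
by rewrite NegzE -[n.+2]addn2 -[n.+1]addn1 !PoszD; ring.
Qed.

Lemma coef_jpartial a b K n :
  jpartial a b K n =
  \sum_(j < K.*2) (-1) ^+ `|j%:Z - K%:Z| * (jexp a b (j%:Z - K%:Z) == n)%:R.
Proof.
have sumE (I : finType) (F : I -> ps) m : (\sum_i F i) m = \sum_i F i m.
  by elim/big_rec2: _ => [|i x y _ <-]; rewrite ?fps_coef0 ?fps_coefD.
rewrite sumE; apply: eq_bigr => j _; rewrite /jterm.
by rewrite -[in LHS]signr_odd -[in RHS]signr_odd; case: odd;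
  rewrite ?expr0 ?expr1 ?mul1r ?mulN1r ?fps_coefN qmonE eq_sym.
Qed.

Lemma thetaE a b n : theta a b n = jpartial a b n.+1 n.
Proof. by rewrite fpsE. Qed.

(** The sign (-1) ^ n from q -> - q cancels the sign (-1) ^ k of every term of exponent n. *)
Lemma psneg_theta_coef a b n : (forall k, odd (jexp a b k) = odd `|k|) ->
  psneg (theta a b) n =
  \sum_(j < n.+1.*2) (jexp a b (j%:Z - n.+1%:Z) == n)%:R.
Proof.
move=> par; rewrite psnegE thetaE coef_jpartial mulr_sumr; apply: eq_bigr => j _.
case: eqP => [jn|]; last by rewrite !mulr0.
by rewrite mulr1 -signr_odd -[in X in _ * X]signr_odd -par jn -expr2 sqrr_sign.
Qed.

Lemma psneg_theta_nonneg a b : (forall k, odd (jexp a b k) = odd `|k|) ->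
  nonneg (psneg (theta a b)).
Proof. by move=> par n; rewrite psneg_theta_coef // sumr_ge0. Qed.

(* Evaluated at - q ^ 2 and multiplied by q ^ r, this is the part of u in degrees
   congruent to r modulo 2. *)
Definition dissect (r : bool) (u : ps) : ps :=
  fps_of (fun n => (-1) ^+ n * u (n.*2 + r)%N).

(** In the convolution (-1) ^ n splits as (-1) ^ i (-1) ^ (n - i), one sign for each factor. *)
Lemma dissect_psdil (r : bool) u v n :
  (-1) ^+ n * (u * psdil v) (n.*2 + r)%N = (dissect r u * psneg v) n.
Proof.
rewrite coefM_psdil [dissect r u * _]mulrC fps_coefM mulr_sumr; apply: eq_bigr => i _.
rewrite psnegE fpsE mulrACA -exprD subnKC -1?ltnS //.
Qed.

(** In degree 2 m + r the term v_m u_r is positive, so u_0 and u_1 serve the two parities. *)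
Lemma positiveM_psdil u v : nonneg u -> 0 < u 0%N -> 0 < u 1%N -> positive v ->
  positive (u * psdil v).
Proof.
move=> u_ge0 u0 u1 v_gt0 n; rewrite -[n]odd_double_half addnC coefM_psdil.
rewrite big_ord_recr /= subnn add0n; apply: ltr_wpDl.
  by apply: sumr_ge0 => i _; apply/mulr_ge0/u_ge0/ltW.
by apply: mulr_gt0 => //; case: odd.
Qed.

Lemma odd_jexp15 k : odd (jexp 1 5 k) = odd `|k|.
Proof. by have := jexp2 1 5 k; nia. Qed.

(** The exponent is 3 k ^ 2 - 2 k: 12 l ^ 2 - 4 l for k = 2 l, and 12 l ^ 2 + 8 l + 1 for k = 2 l +
    1. *)
Lemma jexp15_mod4 k : (jexp 1 5 k %% 4 < 2)%N.
Proof.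
have := jexp2 1 5 k; have [l [->|->]] : exists l : int, k = 2 * l \/ k = 2 * l + 1.
  by exists (k %/ 2)%Z; lia.
all: by move: (jexp _ _ _) => j; lia.
Qed.

Lemma dissect_theta15 (r : bool) : nonneg (dissect r (psneg (theta 1 5))).
Proof.
move=> n; rewrite fpsE; case on: (odd n); last first.
  by rewrite -signr_odd on mul1r; apply/psneg_theta_nonneg/odd_jexp15.
rewrite psneg_theta_coef; last exact: odd_jexp15.
(* For n odd, 2 n + r is 2 or 3 modulo 4, hence never an exponent. *)
rewrite big1 ?mulr0 // => j _; case: eqP => // jn.
by have := jexp15_mod4 (j%:Z - (n.*2 + r).+1%:Z); rewrite jn; case: (r) => /=; lia.
Qed.

Lemma dissect_theta15_coef0 (r : bool) : 0 < dissect r (psneg (theta 1 5)) 0%N.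
Proof.
rewrite fpsE mul1r psneg_theta_coef; last exact: odd_jexp15.
by case: r; rewrite !big_ord_recr big_ord0.
Qed.

Lemma odd_jexp11 k : odd (jexp 1 1 k) = odd `|k|.
Proof. by have := jexp2 1 1 k; nia. Qed.

(* k = 2 l + r turns 2 k ^ 2 - k into twice 4 l ^ 2 - l, resp. 4 l ^ 2 + 3 l, plus r. *)
Lemma dissect_theta13 (r : bool) :
  dissect r (psneg (theta 1 3)) = theta (if r then 7 else 3) (if r then 1 else 5).
Proof.
set a := if r then 7%N else 3%N; set b := if r then 1%N else 5%N.
have [a0 b0] : (0 < a)%N /\ (0 < b)%N by split; rewrite ?/a ?/b; case: ifP.
apply/fpsP => n; rewrite fpsE psnegE [RHS]thetaE.
(* Truncating at 2 (n + 1) lets the indices pair as 2 l, 2 l + 1, with l running over the truncation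
   at n + 1 on the right. *)
rewrite (@eqm_theta 1 3 (n.*2 + r) n.+1.*2) //; last by have := leq_b1 r; lia.
rewrite !coef_jpartial !mulr_sumr.
pose F j : int := (-1) ^+ n * ((-1) ^+ (n.*2 + r) *
  ((-1) ^+ `|j%:Z - n.+1.*2%:Z| * (jexp 1 3 (j%:Z - n.+1.*2%:Z) == n.*2 + r)%N%:R)).
rewrite -[LHS]/(\sum_(j < n.+1.*2.*2) F j) sum_double {}/F.
apply: eq_bigr => j _; set l := j%:Z - n.+1%:Z.
have -> : j.*2%:Z - n.+1.*2%:Z = 2 * l by rewrite /l; lia.
have -> : j.*2.+1%:Z - n.+1.*2%:Z = 2 * l + 1 by rewrite /l; lia.
have J2 := jexp2 1 3 (2 * l); have J3 := jexp2 1 3 (2 * l + 1).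
have J := jexp2 a b l.
rewrite -[(-1) ^+ `|2 * l|]signr_odd -[(-1) ^+ `|2 * l + 1|]signr_odd.
have -> : odd `|2 * l| = false by lia.
have -> : odd `|2 * l + 1| by lia.
rewrite -[(-1) ^+ (_ + r)]signr_odd oddD odd_double.
(* Only the member of the pair with the parity of r can have exponent 2 n + r. *)
have [par E0 E1] : [/\ odd (jexp a b l) = odd `|l|,
    (jexp 1 3 (2 * l) == n.*2 + r)%N = ~~ r && (jexp a b l == n) &
    (jexp 1 3 (2 * l + 1) == n.*2 + r)%N = r && (jexp a b l == n)].
  by clear a0 b0; subst a b; move: J J2 J3; case: r => J J2 J3; split => /=; nia.
rewrite E0 E1; case: eqP => [jn|_]; last by rewrite !andbF !mulr0 addr0.
rewrite -[in RHS]signr_odd -par jn signr_odd !andbT.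
by case: r {a b a0 b0 par E0 E1 jn J}; rewrite /= ?expr1 ?expr0; ring.
Qed.

(** Before the sign change this is f_1 f_6 ^ 2 / (f_2 f_3). *)
Lemma psneg_theta15_eta : psneg (theta 1 5) =
  eta (neg_exp (fun k => chi 1 6 k + chi 5 6 k + dvs 6 k)).
Proof. by rewrite -jacobi_triple // !etaD psneg_eta. Qed.

(** Before the sign change this is f_1 f_4 / f_2. *)
Lemma psneg_theta13_eta : psneg (theta 1 3) =
  eta (neg_exp (fun k => chi 1 4 k + chi 3 4 k + dvs 4 k)).
Proof. by rewrite -jacobi_triple // !etaD psneg_eta. Qed.

(** The coefficient in degree 2 N + r has sign (-1) ^ N; N = 2 n and N = 2 n + 1 give the four
    residues modulo 4. *)
Lemma sign_pattern e u v : eta e = u * psdil v ->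
  (forall r : bool, positive (dissect r u * psneg v)) ->
  forall n, [/\ 0 < eta e (4 * n)%N, 0 < eta e (4 * n + 1)%N,
    eta e (4 * n + 2)%N < 0 & eta e (4 * n + 3)%N < 0].
Proof.
move=> -> pos n; have [p0 p1] := (pos false, pos true).
have := p0 n.*2; have := p1 n.*2; have := p0 n.*2.+1; have := p1 n.*2.+1.
rewrite -!dissect_psdil -!(signr_odd _ n.*2) -!(signr_odd _ n.*2.+1) /= odd_double /=.
rewrite expr0 expr1 !mul1r !mulN1r !oppr_gt0.
have -> : (n.*2.+1.*2 + 1 = 4 * n + 3)%N by lia.
have -> : (n.*2.+1.*2 + 0 = 4 * n + 2)%N by lia.
have -> : (n.*2.*2 + 1 = 4 * n + 1)%N by lia.
have -> : (n.*2.*2 + 0 = 4 * n)%N by lia.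
by [].
Qed.

(** * The three eta quotients *)

Lemma eta_coefE (t1 t2 t3 t4 : int) n : eta_coef [:: t1; t2; t3; t4] n =
  eta (fun k => t1 * dvs 1 k + t2 * dvs 2 k + t3 * dvs 3 k + t4 * dvs 4 k) n.
Proof.
rewrite /eta_coef !big_ord_recr big_ord0 /= mul1r.
by rewrite !qf_eta // !etaXz !etaD.
Qed.

(** The exponent of 1 - q ^ k is 0 for k congruent to 2 modulo 4 and -1 otherwise. *)
Lemma positive_f2_over_f1_f4 : positive (eta (fun k => dvs 2 k + -1 * dvs 1 k + -1 * dvs 4 k)).
Proof. by apply: (@eta_positive_periodic 24); [| prove_periodic | vm_compute | vm_compute]. Qed.

(** In f_3 / f_6 only odd multiples of 3 survive, with exponent 1. *)
Lemma nonneg_psneg_f3_over_f6 : nonneg (psneg (eta (fun k => dvs 3 k + -1 * dvs 6 k))).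
Proof.
apply: psneg_eta_nonneg => k; rewrite /dvs (@Gauss_dvd 2 3) // dvdn2.
by case: odd; case: (3 %| k)%N; [right | left..].
Qed.

Lemma psneg_eta_coef0 e : psneg (eta e) 0%N = 1.
Proof. by rewrite psneg_eta eta_coef0. Qed.

(* f1(- q) ^ 2 / f2 ^ 2 = (sum_k q ^ (k ^ 2)) / f2, by the triple product. *)
Lemma positive_psneg_f1_over_f2_sqr : positive (psneg (eta (fun k => 2 * dvs 1 k + -2 * dvs 2 k))).
Proof.
have -> : psneg (eta (fun k => 2 * dvs 1 k + -2 * dvs 2 k)) =
    psneg (theta 1 1) * psdil (eta (fun k => -1 * dvs 1 k)).
  rewrite -jacobi_triple // !etaD !psneg_eta psdil_eta etaD.
  by apply: (@eq_eta_periodic 24); [| prove_periodic | prove_periodic | vm_compute].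
(* Here 1 / f_2 is the dilation of 1 / f_1, and the theta series begins 1 + 2 q. *)
apply: positiveM_psdil.
- exact/psneg_theta_nonneg/odd_jexp11.
- by rewrite (psneg_theta_coef _ odd_jexp11) !big_ord_recr big_ord0.
- by rewrite (psneg_theta_coef _ odd_jexp11) !big_ord_recr big_ord0.
by apply: (@eta_positive_periodic 24); [| prove_periodic | vm_compute | vm_compute].
Qed.

Lemma sign_pattern_1_3_1_3 n
    (e := fun k => -1 * dvs 1 k + 3 * dvs 2 k + 1 * dvs 3 k + -3 * dvs 4 k) :
  [/\ 0 < eta e (4 * n)%N, 0 < eta e (4 * n + 1)%N,
    eta e (4 * n + 2)%N < 0 & eta e (4 * n + 3)%N < 0].
Proof.
(* U = f_1 f_3 / (f_2 ^ 2 f_6). *)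
apply: (@sign_pattern _ (psneg (theta 1 5))
  (eta (fun k => dvs 1 k + dvs 3 k + -2 * dvs 2 k + -1 * dvs 6 k))) => [|r].
  rewrite psneg_theta15_eta psdil_eta etaD.
  by apply: (@eq_eta_periodic 24); [| rewrite /e; prove_periodic | prove_periodic | vm_compute].
(* Uses f_1(- q) / f_2 ^ 2 = f_2 / (f_1 f_4). *)
have -> : psneg (eta (fun k => dvs 1 k + dvs 3 k + -2 * dvs 2 k + -1 * dvs 6 k)) =
    eta (fun k => dvs 2 k + -1 * dvs 1 k + -1 * dvs 4 k) *
    psneg (eta (fun k => dvs 3 k + -1 * dvs 6 k)).
  rewrite !psneg_eta !etaD.
  by apply: (@eq_eta_periodic 24); [| prove_periodic | prove_periodic | vm_compute].
rewrite mulrC; apply: positiveM; [|exact: dissect_theta15|exact: dissect_theta15_coef0].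
apply: positiveM positive_f2_over_f1_f4 nonneg_psneg_f3_over_f6 _.
by rewrite psneg_eta_coef0.
Qed.

Lemma sign_pattern_1_4_1_3 n
    (e := fun k => -1 * dvs 1 k + 4 * dvs 2 k + 1 * dvs 3 k + -3 * dvs 4 k) :
  [/\ 0 < eta e (4 * n)%N, 0 < eta e (4 * n + 1)%N,
    eta e (4 * n + 2)%N < 0 & eta e (4 * n + 3)%N < 0].
Proof.
(* U = f_1 ^ 2 f_3 / (f_2 ^ 2 f_6), regrouped below as (f_1 / f_2) ^ 2 times f_3 / f_6. *)
apply: (@sign_pattern _ (psneg (theta 1 5))
  (eta (fun k => 2 * dvs 1 k + dvs 3 k + -2 * dvs 2 k + -1 * dvs 6 k))) => [|r].
  rewrite psneg_theta15_eta psdil_eta etaD.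
  by apply: (@eq_eta_periodic 24); [| rewrite /e; prove_periodic | prove_periodic | vm_compute].
have -> : psneg (eta (fun k => 2 * dvs 1 k + dvs 3 k + -2 * dvs 2 k + -1 * dvs 6 k)) =
    psneg (eta (fun k => 2 * dvs 1 k + -2 * dvs 2 k)) *
    psneg (eta (fun k => dvs 3 k + -1 * dvs 6 k)).
  rewrite -rmorphM etaD; congr (psneg _).
  by apply: (@eq_eta_periodic 24); [| prove_periodic | prove_periodic | vm_compute].
rewrite mulrC; apply: positiveM; [|exact: dissect_theta15|exact: dissect_theta15_coef0].
apply: positiveM positive_psneg_f1_over_f2_sqr nonneg_psneg_f3_over_f6 _.
by rewrite psneg_eta_coef0.
Qed.

Lemma sign_pattern_1_4_0_4 n
    (e := fun k => -1 * dvs 1 k + 4 * dvs 2 k + 0 * dvs 3 k + -4 * dvs 4 k) :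
  [/\ 0 < eta e (4 * n)%N, 0 < eta e (4 * n + 1)%N,
    eta e (4 * n + 2)%N < 0 & eta e (4 * n + 3)%N < 0].
Proof.
(* U = f_1 ^ 2 / f_2 ^ 4, so U(- q) = f_2 ^ 2 / (f_1 f_4) ^ 2. *)
apply: (@sign_pattern _ (psneg (theta 1 3))
  (eta (fun k => 2 * dvs 1 k + -4 * dvs 2 k))) => [|r].
  rewrite psneg_theta13_eta psdil_eta etaD.
  by apply: (@eq_eta_periodic 24); [| rewrite /e; prove_periodic | prove_periodic | vm_compute].
rewrite dissect_theta13 psneg_eta.
(* The theta factor raises exponents by at most 1, at multiples of 8 and two odd classes modulo 8,
   where U(- q) has exponent -2. *)
by case: r; rewrite -jacobi_triple // !etaD;
  (apply: (@eta_positive_periodic 24);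
    [| prove_periodic | vm_compute | vm_compute]).
Qed.

Theorem theorem4p2 (t1 t2 t3 t4 : int) (ht : (t1, t2, t3, t4) \in S5)
    (n : nat) :
  [/\ 0 < eta_coef [:: t1; t2; t3; t4] (4 * n)%N,
      0 < eta_coef [:: t1; t2; t3; t4] (4 * n + 1)%N,
      eta_coef [:: t1; t2; t3; t4] (4 * n + 2)%N < 0 &
      eta_coef [:: t1; t2; t3; t4] (4 * n + 3)%N < 0].
Proof.
rewrite !eta_coefE.
move: ht; rewrite !inE => /or3P[] /eqP[-> -> -> ->].
- exact: sign_pattern_1_3_1_3.
- exact: sign_pattern_1_4_1_3.
- exact: sign_pattern_1_4_0_4.
Qed.
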